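(* Let $k\ge 2$, $\Sigma=\{\sigma_1,\dots,\sigma_k\}$, let $B_k(z)=\sum_{\beta} z^{|\beta|}$ be the generating function of all regular expressions over $\Sigma$, and $R_k(z)=\sum_{\alpha\in\mathrm{RE}_{na}} z^{|\alpha|}$ that of $\mathrm{RE}_{na}$ (both defined below). Then $$\frac{[z^n]R_k(z)}{[z^n]B_k(z)} \sim \frac{\sqrt{\psi_k(\eta_k)}}{\sqrt{2-2\rho_k}}\left(\frac{\rho_k}{\eta_k}\right)^{n+1}\qquad (n\to\infty),$$ where $\rho_k=\frac{1}{1+\sqrt{8+8k}}$.
   Context: Regular expressions over $\Sigma$ are generated by $\beta := \varepsilon \mid \sigma\ (\sigma\in\Sigma) \mid (\beta+\beta) \mid (\beta\cdot\beta) \mid (\beta^\star)$ (the empty-set expression is not counted). The size $|\beta|$ is the number of occurrences of the symbols $\varepsilon$, letters, $+$, $\cdot$, $\star$ in $\beta$ (parentheses not counted). A $\Sigma$-star expression is an expression $(\tau^\star)$ where $\tau$ is a fully parenthesized union of the $k$ letters, each occurring exactly once, in any order and any bracketing; there are $C_k:=\frac{(2k-2)!}{(k-1)!}$ of them, each of size $2k$. $\mathrm{RE}_{na}$ is the set of regular expressions having no subexpression $(\beta_1+\beta_2)$ in which $\beta_1$ or $\beta_2$ is a $\Sigma$-star expression. Define $p_k(z)=1-2z-(7+8k)z^2$, $h_k(z)=1-z-C_k z^{2k+1}$, $\Delta_k(z)=p_k(z)+4z^{2k+1}C_k h_k(z)$. Let $\eta_k$ be the unique real root of $\Delta_k$ in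 $\left(0,\frac{1}{\sqrt{8+8k}}\right)$, and $\psi_k(\eta_k):=-\eta_k\Delta_k'(\eta_k)$. $[z^n]F(z)$ denotes the coefficient of $z^n$, and $a_n\sim b_n$ means $a_n/b_n\to1$. *)

(* Defs.v *)
From mathcomp Require Import all_boot.
From Stdlib Require Import Reals.
From Coquelicot Require Import Coquelicot.

Set Implicit Arguments.
Unset Strict Implicit.

Inductive re (k : nat) : Type :=
| Eps : re k
| Lit : 'I_k -> re k
| Plus : re k -> re k -> re k
| Cat : re k -> re k -> re k
| Star : re k -> re k.

Arguments Eps {k}.

Fixpoint re_size k (b : re k) : nat :=
  match b with
  | Eps => 1
  | Lit _ => 1
  | Plus b1 b2 => (re_size b1 + re_size b2).+1
  | Cat b1 b2 => (re_size b1 + re_size b2).+1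
  | Star b1 => (re_size b1).+1
  end.

Fixpoint union_leaves k (t : re k) : option (seq 'I_k) :=
  match t with
  | Lit a => Some [:: a]
  | Plus t1 t2 =>
      match union_leaves t1, union_leaves t2 with
      | Some s1, Some s2 => Some (s1 ++ s2)
      | _, _ => None
      end
  | _ => None
  end.

Definition sigma_star k (b : re k) : bool :=
  match b with
  | Star t =>
      match union_leaves t with
      | Some s => perm_eq s (enum 'I_k)
      | None => false
      end
  | _ => false
  end.

Fixpoint in_RE_na k (b : re k) : bool :=
  match b with
  | Eps => true
  | Lit _ => true
  | Plus b1 b2 =>
      [&& ~~ sigma_star b1, ~~ sigma_star b2, in_RE_na b1 & in_RE_na b2]
  | Cat b1 b2 => in_RE_na b1 && in_RE_na b2
  | Star b1 => in_RE_na b1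
  end.

Definition has_card (T : Type) (A : T -> Prop) (N : nat) : Prop :=
  exists f : 'I_N -> T, injective f /\ (forall x, A x <-> exists i, f i = x).

(* [z^n] B_k(z) and [z^n] R_k(z) are the numbers of expressions of size n
   (resp. of expressions of size n in RE_na). *)
Definition is_coef_B (k : nat) (Bc : nat -> nat) : Prop :=
  forall n, has_card (fun b : re k => re_size b = n) (Bc n).
Definition is_coef_R (k : nat) (Rc : nat -> nat) : Prop :=
  forall n, has_card (fun b : re k => re_size b = n /\ in_RE_na b) (Rc n).

Local Open Scope R_scope.

Definition Ck (k : nat) : R := INR ((2 * k - 2)`!)%nat / INR ((k - 1)`!)%nat.

Definition pk (k : nat) (z : R) : R := 1 - 2 * z - (7 + 8 * INR k) * z ^ 2.
Definition hk (k : nat) (z : R) : R := 1 - z - Ck k * z ^ (2 * k + 1)%nat.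
Definition Deltak (k : nat) (z : R) : R :=
  pk k z + 4 * z ^ (2 * k + 1)%nat * Ck k * hk k z.

Definition psik (k : nat) (eta : R) : R := - eta * Derive (Deltak k) eta.

Definition rhok (k : nat) : R := 1 / (1 + sqrt (8 + 8 * INR k)).

(* Main.v *)
(* Counting the last constructor gives quadratic equations for the generating functions B and R,
   with discriminants p_k and Delta_k; hence [z^n]B and [z^n]R are, for large n, -1/4 times the
   coefficient of z^(n+1) in the square root of the discriminant.

   No complex analysis is needed.  After rescaling z by the root e of the discriminant, the latter
   factors as (1 - X)(1 - y(X)) with y(0) = 0, and the absolute values of the coefficients of y sum
   to less than 1, because C_k e^(2k) is tiny for e < 1 / sqrt (8 + 8k).  Then
   g = sqrt (1 - y) = 1 - w satisfies 2w = y + w^2, so w has coefficients bounded by r^(-n) for some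
   r > 1, and the coefficients of sqrt (1 - X) g are asymptotic to g(1) times those of
   sqrt (1 - X).  The latter cancel in the quotient, and g(1)^2 = 1 - y(1) is -e Delta_k'(e). *)

Require Import Defs.
From HB Require Import structures.
From mathcomp Require Import all_boot zify.
From Stdlib Require Import Reals Lra FunctionalExtensionality IndefiniteDescription.
From Coquelicot Require Import Coquelicot.

Local Open Scope R_scope.

(** * Formal power series over R *)

Definition fps := nat -> R.
Definition fadd (f g : fps) : fps := fun n => f n + g n.
Definition fopp (f : fps) : fps := fun n => - f n.
Definition fsub (f g : fps) : fps := fun n => f n - g n.
Definition fmul (f g : fps) : fps := fun n => sum_f_R0 (fun i => f i * g (n - i)%nat) n.
Definition cst (c : R) : fps := fun n => if n is 0%nat then c else 0.
Definition mono (m : nat) : fps := fun n => if n == m then 1 else 0.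
Definition tl (f : fps) : fps := fun n => f n.+1.
(** The substitution f(cX). *)
Definition scale (c : R) (f : fps) : fps := fun n => f n * c ^ n.
(** The operator X d/dX. *)
Definition theta (f : fps) : fps := fun n => INR n * f n.
(** The series 1 / (1 - X); multiplying by it takes partial sums. *)
Definition geom : fps := fun=> 1.

Lemma fmulE f g n : fmul f g n = sum_f_R0 (fun i => f i * g (n - i)%nat) n.
Proof. by []. Qed.

Lemma sum_eq_le (f g : nat -> R) n :
  (forall i, (i <= n)%nat -> f i = g i) -> sum_f_R0 f n = sum_f_R0 g n.
Proof. by move=> H; apply: sum_eq => i Hi; apply: H; lia. Qed.

Lemma sum_le_le (f g : nat -> R) n :
  (forall i, (i <= n)%nat -> f i <= g i) -> sum_f_R0 f n <= sum_f_R0 g n.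
Proof. by move=> H; apply: sum_Rle => i Hi; apply: H; lia. Qed.

Lemma fmul0 f g : fmul f g 0%nat = f 0%nat * g 0%nat.
Proof. by []. Qed.

Lemma fmulSl f g n : fmul f g n.+1 = f 0%nat * g n.+1 + fmul (tl f) g n.
Proof.
rewrite fmulE decomp_sum; last by lia.
by congr (_ + _).
Qed.

Lemma fmulSr f g n : fmul f g n.+1 = f n.+1 * g 0%nat + fmul f (tl g) n.
Proof.
rewrite fmulE /= subnn Rplus_comm; congr (_ + _).
by apply: sum_eq_le => i Hi; rewrite /tl subSn.
Qed.

Lemma fmul_addl f g h : fmul (fadd f g) h = fadd (fmul f h) (fmul g h).
Proof.
apply: functional_extensionality => n; rewrite /fadd !fmulE -plus_sum.
by apply: sum_eq_le => i _; ring.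
Qed.

Lemma fmulC f g : fmul f g = fmul g f.
Proof.
apply: functional_extensionality => n; elim: n f g => [|n IH] f g.
  by rewrite !fmul0; ring.
by rewrite fmulSl fmulSr IH; ring.
Qed.

Lemma cstM_E c f n : fmul (cst c) f n = c * f n.
Proof.
case: n => [|n]; first by rewrite fmul0.
rewrite fmulSl /=; suff -> : fmul (tl (cst c)) f n = 0 by ring.
rewrite fmulE (sum_eq_le _ (fun=> 0)) ?sum_cte; first by ring.
by move=> i _; rewrite /tl /=; ring.
Qed.

Lemma tl_fmul f g : tl (fmul f g) = fadd (fmul (cst (f 0%nat)) (tl g)) (fmul (tl f) g).
Proof. by apply: functional_extensionality => n; rewrite {1}/tl fmulSl /fadd cstM_E. Qed.

(** Peeling off the constant term of [f] turns coefficient n + 1 into coefficient n for [tl f], so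
    one induction replaces an exchange of double sums. *)
Lemma fmulA f g h : fmul f (fmul g h) = fmul (fmul f g) h.
Proof.
apply: functional_extensionality => n; elim: n f g => [|n IH] f g.
  by rewrite !fmul0; ring.
have cstA c p q m : fmul (fmul (cst c) p) q m = c * fmul p q m.
  rewrite !fmulE scal_sum; apply: sum_eq_le => i _; rewrite cstM_E; ring.
rewrite !fmulSl IH tl_fmul fmul_addl fmul0 /fadd cstA; ring.
Qed.

Lemma fps_ring_theory : ring_theory (cst 0) (cst 1) fadd fmul fsub fopp (@eq fps).
Proof.
split.
- by move=> f; apply: functional_extensionality => -[|n]; rewrite /fadd /=; ring.
- by move=> f g; apply: functional_extensionality => n; rewrite /fadd; ring.
- by move=> f g h; apply: functional_extensionality => n; rewrite /fadd; ring.
- by move=> f; apply: functional_extensionality => n; rewrite cstM_E; ring.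
- exact: fmulC.
- exact: fmulA.
- exact: fmul_addl.
- by [].
- by move=> f; apply: functional_extensionality => -[|n]; rewrite /fadd /fopp /=; ring.
Qed.

Add Ring fps_ring : fps_ring_theory.

Declare Scope fps_scope.
Delimit Scope fps_scope with fps.
Bind Scope fps_scope with fps.
Infix "+" := fadd : fps_scope.
Infix "*" := fmul : fps_scope.
Infix "-" := fsub : fps_scope.
Notation "- f" := (fopp f) : fps_scope.
Notation "1" := (cst 1) : fps_scope.

Lemma fadd_cst a b : (cst (a + b) = cst a + cst b)%fps.
Proof. by apply: functional_extensionality => -[|n]; rewrite /fadd /=; ring. Qed.
Lemma fsub_cst a b : (cst (a - b) = cst a - cst b)%fps.
Proof. by apply: functional_extensionality => -[|n]; rewrite /fsub /=; ring. Qed.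
Lemma fmul_cst a b : (cst (a * b) = cst a * cst b)%fps.
Proof. by apply: functional_extensionality => n; rewrite cstM_E; case: n => [|n] /=; ring. Qed.

Lemma scale_mul c f g : (scale c (f * g) = scale c f * scale c g)%fps.
Proof.
apply: functional_extensionality => n; rewrite /scale !fmulE.
rewrite Rmult_comm scal_sum; apply: sum_eq_le => i Hi.
have -> : c ^ n = c ^ i * c ^ (n - i)%nat by rewrite -pow_add; congr (_ ^ _); lia.
ring.
Qed.
Lemma scale_add c f g : (scale c (f + g) = scale c f + scale c g)%fps.
Proof. by apply: functional_extensionality => n; rewrite /scale /fadd; ring. Qed.
Lemma scale_sub c f g : (scale c (f - g) = scale c f - scale c g)%fps.
Proof. by apply: functional_extensionality => n; rewrite /scale /fsub; ring. Qed.
Lemma scale_cst c a : (scale c (cst a) = cst a)%fps.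
Proof. by apply: functional_extensionality => -[|n]; rewrite /scale /=; ring. Qed.
Lemma scale_mono c m : (scale c (mono m) = cst (c ^ m) * mono m)%fps.
Proof.
apply: functional_extensionality => n; rewrite cstM_E /scale /mono.
by case: eqP => [->|_]; ring.
Qed.

Lemma monoM_E m f n : (mono m * f)%fps n = if (m <= n)%nat then f (n - m)%nat else 0.
Proof.
elim: m n f => [|m IH] n f.
  have -> : mono 0 = cst 1 by apply: functional_extensionality => -[|i].
  by rewrite cstM_E subn0 leq0n Rmult_1_l.
case: n => [|n]; first by rewrite fmul0 /mono /=; ring.
rewrite fmulSl /mono /= Rmult_0_l Rplus_0_l.
have -> : tl (fun n0 : nat => if n0 == m.+1 then 1 else 0) = mono m by [].
by rewrite IH.
Qed.

Lemma mono_mul m p : (mono m * mono p = mono (m + p))%fps.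
Proof.
apply: functional_extensionality => n; rewrite monoM_E /mono.
by case: leqP => H; do ?case: eqP => //; lia.
Qed.

Lemma theta_mul f g : (theta (f * g) = theta f * g + f * theta g)%fps.
Proof.
apply: functional_extensionality => n; rewrite /theta /fadd !fmulE -plus_sum.
rewrite scal_sum; apply: sum_eq_le => i Hi.
rewrite minus_INR; [ring|lia].
Qed.

Lemma geom_mul f n : (geom * f)%fps n = sum_f_R0 f n.
Proof.
by rewrite fmulC fmulE; apply: sum_eq_le => i _; rewrite /geom; ring.
Qed.

Lemma geomE : (geom * (1 - mono 1))%fps = 1%fps.
Proof.
apply: functional_extensionality => n; rewrite geom_mul.
case: n => [|n]; first by rewrite /= /fsub /mono /=; ring.
elim: n => [|n IH]; first by rewrite /= /fsub /mono /=; ring.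
by rewrite [sum_f_R0 _ _]/= -/(sum_f_R0 _ n.+1) IH /fsub /mono /=; ring.
Qed.

(** The polynomial X^m + ... + X^(n-1), that is (X^m - X^n) / (1 - X); it serves to divide the
    discriminants by 1 - X. *)
Definition gs (m n : nat) : fps := fun i => if (m <= i < n)%nat then 1 else 0.

Lemma gsE m n : (m <= n)%nat -> ((1 - mono 1) * gs m n = mono m - mono n)%fps.
Proof.
move=> Hmn; apply: functional_extensionality => i.
have -> : ((1 - mono 1) * gs m n = gs m n - mono 1 * gs m n)%fps by ring.
rewrite /fsub monoM_E /gs /mono.
case: i => [|i] /=; do ?[case: ifP => ?] => /=; try ring; try lia.
Qed.

(* Coefficients of sqrt (1 - X): binomials with upper argument 1/2, up to sign. *)
Fixpoint sq (n : nat) : R :=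
  if n is m.+1 then sq m * (INR m - / 2) / (INR m + 1) else 1.

Lemma sqS n : sq n.+1 = sq n * (INR n - / 2) / (INR n + 1).
Proof. by []. Qed.

(** The differential equation of sqrt (1 - X), read off from the recurrence for [sq]. *)
Lemma sq_ode : ((1 - mono 1) * theta sq = - (cst (/ 2) * mono 1 * sq))%fps.
Proof.
apply: functional_extensionality => i.
have -> : ((1 - mono 1) * theta sq = theta sq - mono 1 * theta sq)%fps by ring.
have -> : (cst (/ 2) * mono 1 * sq = cst (/ 2) * (mono 1 * sq))%fps by ring.
rewrite /fsub /fopp cstM_E !monoM_E /theta.
case: i => [|i]; first by rewrite /=; ring.
rewrite sqS S_INR ltn0Sn subn1 [i.+1.-1]/=.
by have := pos_INR i => H; field; lra.
Qed.

Lemma sq_sq : (sq * sq = 1 - mono 1)%fps.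
Proof.
set v := (sq * sq)%fps.
(* The square inherits a linear differential equation from [sq]; its recurrence and v_0 = 1
   determine all coefficients. *)
have ode : ((1 - mono 1) * theta v = - (mono 1 * v))%fps.
  have h : (cst (/2) + cst (/2) = 1)%fps by rewrite -fadd_cst; congr cst; lra.
  rewrite /v theta_mul.
  have -> : ((1 - mono 1) * (theta sq * sq + sq * theta sq) =
     (1 - mono 1) * theta sq * sq + sq * ((1 - mono 1) * theta sq))%fps by ring.
  rewrite sq_ode.
  have -> : (- (cst (/ 2) * mono 1 * sq) * sq + sq * - (cst (/ 2) * mono 1 * sq) =
     - ((cst (/2) + cst (/2)) * mono 1 * (sq * sq)))%fps by ring.
  by rewrite h; ring.
(* The factor n - 1 vanishes at n = 1, which kills every coefficient from index 2 on. *)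
have rec n : (INR n + 1) * v n.+1 = (INR n - 1) * v n.
  have := equal_f ode n.+1.
  have -> : ((1 - mono 1) * theta v = theta v - mono 1 * theta v)%fps by ring.
  rewrite /fsub /fopp !monoM_E /theta ltn0Sn subn1 [n.+1.-1]/= S_INR; lra.
have v0 : v 0%nat = 1 by rewrite /v fmul0 /=; ring.
have v1 : v 1%nat = -1 by have := rec 0%nat; rewrite /= v0; lra.
have v2 n : v n.+2 = 0.
  elim: n => [|n IH].
    by have := rec 1%nat; rewrite /= v1; lra.
  have := rec n.+2; rewrite IH; have := pos_INR n.+2 => H H2.
  by apply: (Rmult_eq_reg_l (INR n.+2 + 1)); lra.
apply: functional_extensionality => -[|[|n]]; rewrite ?v0 ?v1 ?v2 /fsub /mono /=; ring.
Qed.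

Lemma sq_lt0 n : sq n.+1 < 0.
Proof.
elim: n => [|n IH]; first by rewrite /=; lra.
rewrite sqS S_INR; have := pos_INR n => H.
have : 0 < (- sq n.+1) * (INR n + 1 - / 2) / (INR n + 1 + 1).
  by apply: Rdiv_lt_0_compat; [apply: Rmult_lt_0_compat|]; lra.
by rewrite /Rdiv => ?; lra.
Qed.

Lemma sq_neq0 n : sq n <> 0.
Proof. by case: n => [|n]; [rewrite /=|have := sq_lt0 n]; lra. Qed.

(** * Coefficients of square roots *)

Lemma sum_ge0 f n : (forall i, 0 <= f i) -> 0 <= sum_f_R0 f n.
Proof. by move=> H; apply: cond_pos_sum. Qed.

Lemma sum_incr_le f m n : (forall i, 0 <= f i) -> (m <= n)%nat ->
  sum_f_R0 f m <= sum_f_R0 f n.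
Proof.
move=> Hf Hm; rewrite -(subnK Hm); elim: (n - m)%nat => [|p IH]; first by rewrite add0n; lra.
by rewrite addSn [X in _ <= X]/=; have := Hf (p + m).+1; lra.
Qed.

(** Partial sums are products with [geom], which can be moved onto [g] alone; each partial sum of
    [g] that then arises is at most the n-th. *)
Lemma sum_fmul_le (f g : fps) n : (forall i, 0 <= f i) -> (forall i, 0 <= g i) ->
  sum_f_R0 (f * g)%fps n <= sum_f_R0 f n * sum_f_R0 g n.
Proof.
move=> Hf Hg; rewrite -geom_mul.
have -> : (geom * (f * g) = f * (geom * g))%fps by ring.
rewrite fmulE Rmult_comm scal_sum; apply: sum_le_le => i Hi.
apply: Rmult_le_compat_l => //; rewrite geom_mul.
by apply: sum_incr_le => //; exact: leq_subr.
Qed.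

Lemma abs_fmul_le (f g : fps) n :
  Rabs ((f * g)%fps n) <= ((fun i => Rabs (f i)) * (fun i => Rabs (g i)))%fps n.
Proof.
rewrite !fmulE; apply: Rle_trans (Rsum_abs _ _) _.
by apply: sum_le_le => i _; rewrite Rabs_mult; lra.
Qed.

(* The equation is that of w = 1 - sqrt (1 - y); the partial sums W_n of |w_i| satisfy
   2 W_(n+1) <= 1 + W_(n+1) W_n since w_0 = 0. *)
Lemma sqrt_coef_bound (y w : fps) :
  w 0%nat = 0 -> (w + w = y + w * w)%fps ->
  (forall n, sum_f_R0 (fun i => Rabs (y i)) n <= 1) ->
  forall n, sum_f_R0 (fun i => Rabs (w i)) n <= 1.
Proof.
move=> w0 E Hy; set v := fun i => Rabs (w i).
have v0 : v 0%nat = 0 by rewrite /v w0 Rabs_R0.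
have vge i : 0 <= v i by exact: Rabs_pos.
elim=> [|n IH]; first by rewrite /= v0; lra.
have H1 : 2 * sum_f_R0 v n.+1 <= sum_f_R0 (fun i => Rabs (y i)) n.+1 + sum_f_R0 (v * v)%fps n.+1.
  rewrite -plus_sum scal_sum; apply: sum_le_le => i _.
  have := equal_f E i; rewrite /fadd => Ei.
  have := abs_fmul_le w w i; have := Rabs_triang (y i) ((w * w)%fps i).
  rewrite -Ei -/v; have -> : w i + w i = w i * 2 by ring.
  by rewrite Rabs_mult (Rabs_pos_eq 2) -/(v i); lra.
have H2 : sum_f_R0 (v * v)%fps n.+1 <= sum_f_R0 (tl v) n * sum_f_R0 v n.
  rewrite decomp_sum; last by lia.
  rewrite fmul0 v0 Rmult_0_l Rplus_0_l /=.
  rewrite (sum_eq_le _ (tl v * v)%fps); last by move=> i _; rewrite fmulSl v0; ring.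
  by apply: sum_fmul_le => // i; exact: vge.
have H3 : sum_f_R0 v n.+1 = sum_f_R0 (tl v) n.
  by rewrite decomp_sum; [rewrite v0 Rplus_0_l|lia].
(* By induction W_n <= 1, so 2 - W_n >= 1 and W_(n+1) (2 - W_n) <= 1 gives the claim. *)
have := Hy n.+1; have := sum_ge0 (tl v) n (fun i => vge i.+1).
have := sum_ge0 v n vge; nra.
Qed.

(** * Transfer of coefficient asymptotics from sqrt (1 - X) *)

(** An exact d-th root is avoided: from exponent d >= 1 to d + 1, replacing r by its square root
    suffices, because d + 1 <= 2 d. *)
Lemma root_gt1 M d : 1 < M -> exists r, 1 < r /\ r ^ d <= M.
Proof.
move=> HM; elim: d => [|d [r [r1 Hr]]]; first by exists 2; rewrite /=; lra.
case: d Hr => [|d] Hr; first by exists M; rewrite /=; lra.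
have s1 : 1 < sqrt r by rewrite -sqrt_1; apply: sqrt_lt_1; lra.
exists (sqrt r); split=> //; apply: Rle_trans Hr.
have E : r ^ d.+1 = (sqrt r) ^ (2 * d.+1).
  by rewrite pow_mult; congr (_ ^ _); rewrite pow2_sqrt; lra.
by rewrite E; apply: Rle_pow; [lra|lia].
Qed.

(** Dominated convergence for sums: the first terms, finitely many, tend to 0 one by one, and the
    others are dominated by a tail of the series of [M], small uniformly in n. *)
Lemma tannery (f : nat -> nat -> R) (M : nat -> R) :
  ex_series M -> (forall n j, (j <= n)%nat -> Rabs (f n j) <= M j) ->
  (forall j, is_lim_seq (fun n => f n j) 0) ->
  is_lim_seq (fun n => sum_f_R0 (f n) n) 0.
Proof.
move=> [l Hl] HM Hf.
have Hfin J : is_lim_seq (fun n => sum_f_R0 (f n) J) 0.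
  elim: J => [|J IH] /=; first exact: Hf.
  have -> : 0 = 0 + 0 by ring.
  exact: is_lim_seq_plus'.
have split_ n J m : (J <= m)%nat -> (m <= n)%nat ->
    Rabs (sum_f_R0 (f n) m) <= Rabs (sum_f_R0 (f n) J) + (sum_f_R0 M m - sum_f_R0 M J).
  elim: m => [|m IH] HJ Hn.
    by rewrite (_ : J = 0%nat); [lra|lia].
  have [->|neq] := eqVneq J m.+1; first by lra.
  have := IH ltac:(lia) ltac:(lia).
  have := Rabs_triang (sum_f_R0 (f n) m) (f n m.+1).
  by have := HM n m.+1 Hn; rewrite /=; lra.
have Hl' : is_lim_seq (fun n => sum_f_R0 M n) l.
  by apply: (is_lim_seq_ext (sum_n M)) => [n|]; [rewrite sum_n_Reals|exact: Hl].
apply/is_lim_seq_spec => eps; have He := cond_pos eps.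
(* The head costs eps / 4, and the tail of [M] between J and n costs eps / 4 at each end. *)
have /is_lim_seq_spec/(_ (mkposreal (eps / 4) ltac:(lra)))/= [J HJ] := Hl'.
have /is_lim_seq_spec/(_ (mkposreal (eps / 4) ltac:(lra)))/= [N HN] := Hfin J.
exists (J + N)%nat => n Hn.
have HJn := HJ n ltac:(lia); have HJJ := HJ J (Nat.le_refl _); have HNn := HN n ltac:(lia).
have := split_ n J n ltac:(lia) ltac:(lia).
move: HJn HJJ HNn; rewrite !Rminus_0_r => /Rabs_def2 ? /Rabs_def2 ? ?; lra.
Qed.

(* Makes sq (n - j) / sq n at most quadratic in j, uniformly in n, so that dominated
   convergence applies against geometrically decaying coefficients. *)
Lemma sq_mono i : (1 <= i)%nat ->
  INR i ^ 2 * Rabs (sq i) <= INR i.+1 ^ 2 * Rabs (sq i.+1).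
Proof.
move=> Hi; have H1 : 1 <= INR i by apply: (le_INR 1); lia.
rewrite sqS S_INR /Rdiv !Rabs_mult (Rabs_pos_eq (INR i - / 2)); last by lra.
rewrite (Rabs_pos_eq (/ _)); last by apply/Rlt_le/Rinv_0_lt_compat; lra.
(* The claim reduces to i^2 <= (i + 1)(i - 1/2), which holds exactly from i = 1 on. *)
have -> : (INR i + 1) ^ 2 * (Rabs (sq i) * (INR i - / 2) * / (INR i + 1)) =
   ((INR i + 1) * (INR i - / 2)) * Rabs (sq i) by field; lra.
by apply: Rmult_le_compat_r; [exact: Rabs_pos|nra].
Qed.

(** For j < n, monotonicity of i^2 |sq i| combines with n <= (n - j)(j + 1). The factor 2 is for j =
    n, where sq 0 = 1 has to be compared with |sq 1| = 1/2. *)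
Lemma sq_ratio_bound n j : (j <= n)%nat -> Rabs (sq (n - j)) <= 2 * (INR j + 1) ^ 2 * Rabs (sq n).
Proof.
have mono_ i p : (1 <= i)%nat -> INR i ^ 2 * Rabs (sq i) <= INR (p + i) ^ 2 * Rabs (sq (p + i)).
  move=> Hi; elim: p => [|p IH]; first by rewrite add0n; lra.
  by apply: Rle_trans IH _; rewrite addSn; apply: sq_mono; lia.
move=> Hj; have Hj0 := pos_INR j.
have Hn0 := Rabs_pos (sq n).
case: (posnP (n - j)%nat) => [E|Hi].
  have Enj : n = j by lia.
  rewrite E; case: (posnP n) => [n0|npos].
    by rewrite n0 -Enj n0 /= Rabs_R1; lra.
  have := mono_ 1%nat (n - 1)%nat isT; rewrite subnK // -Enj.
  rewrite [sq 1]/= [INR 1]/= [sq 0]/=.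
  have -> : 1 * (0 - / 2) / (0 + 1) = - / 2 by field.
  by rewrite Rabs_Ropp Rabs_R1 Rabs_pos_eq; [have := pos_INR n; nra|lra].
have := mono_ (n - j)%nat j Hi.
have -> : (j + (n - j) = n)%nat by lia.
have Hi1 : 1 <= INR (n - j) by apply: (le_INR 1); lia.
have En : INR n = INR (n - j) + INR j by rewrite -plus_INR; congr INR; lia.
move=> H.
have H2 : INR n ^ 2 <= INR (n - j) ^ 2 * (INR j + 1) ^ 2.
  by rewrite -Rpow_mult_distr; apply: pow_incr; rewrite En; nra.
have H3 : INR (n - j) ^ 2 * Rabs (sq (n - j)) <= INR (n - j) ^ 2 * ((INR j + 1) ^ 2 * Rabs (sq n)).
  by apply: Rle_trans H _; rewrite -Rmult_assoc; apply: Rmult_le_compat_r.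
have H4 := Rmult_le_reg_l _ _ _ (pow_lt (INR (n - j)) 2 ltac:(lra)) H3.
by have := Rmult_le_pos _ _ (pow_le (INR j + 1) 2 ltac:(lra)) Hn0; lra.
Qed.

Lemma lim_inv_INR c d : is_lim_seq (fun n => c / (INR n + d)) 0.
Proof.
have H : is_lim_seq (fun n => INR n + d) p_infty.
  apply: is_lim_seq_plus is_lim_seq_INR (is_lim_seq_const d) _ => //.
have := is_lim_seq_scal_l _ c _ (is_lim_seq_inv _ _ H ltac:(done)).
by rewrite /= Rmult_0_r.
Qed.

Lemma sq_ratio_lim j : is_lim_seq (fun n => sq (n - j) / sq n) 1.
Proof.
apply/(is_lim_seq_incr_n _ j).
apply: (is_lim_seq_ext (fun n => sq n / sq (n + j))) => [n|].
  by rewrite -[Nat.add _ _]/(n + j)%nat addnK.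
elim: j => [|j IH].
  apply: (is_lim_seq_ext (fun=> 1)) => [n|]; last exact: is_lim_seq_const.
  by rewrite addn0; field; exact: sq_neq0.
(* This is the factor sq (n + j) / sq (n + j + 1) = (n + j + 1) / (n + j - 1/2). *)
have H : is_lim_seq (fun n => 1 + (3 / 2) / (INR n + (INR j - / 2))) (1 + 0).
  by apply: is_lim_seq_plus'; [exact: is_lim_seq_const|exact: lim_inv_INR].
have -> : 1 = 1 * (1 + 0) by ring.
apply: is_lim_seq_ext_loc _ (is_lim_seq_mult' _ _ _ _ IH H).
exists 1%nat => n Hn.
have Hn1 : 1 <= INR n by apply: (le_INR 1); lia.
have Hj := pos_INR j.
rewrite addnS sqS plus_INR; field.
by have := sq_neq0 (n + j); lra.
Qed.

Lemma ex_series_sq_geom q : 0 < q < 1 -> ex_series (fun j => (INR j + 1) ^ 2 * q ^ j).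
Proof.
move=> Hq.
have pos j : 0 < (INR j + 1) ^ 2 * q ^ j.
  by have := pos_INR j => ?; apply: Rmult_lt_0_compat; apply: pow_lt; lra.
apply: (ex_series_ext (fun j => Rabs ((INR j + 1) ^ 2 * q ^ j))) => [j|].
  by rewrite Rabs_pos_eq //; apply/Rlt_le/pos.
apply: (ex_series_DAlembert _ q); first by lra.
  by move=> j; have := pos j; lra.
have H : is_lim_seq (fun n => 1 + 1 / (INR n + 1)) (1 + 0).
  by apply: is_lim_seq_plus'; [exact: is_lim_seq_const|exact: lim_inv_INR].
rewrite (_ : Finite q = Finite (q * ((1 + 0) * (1 + 0)))); last by congr Finite; ring.
have H2 := is_lim_seq_mult' _ _ _ _ (is_lim_seq_const q) (is_lim_seq_mult' _ _ _ _ H H).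
apply: is_lim_seq_ext _ H2 => n; have := pos_INR n => Hn.
rewrite Rabs_pos_eq; last by apply/Rlt_le/Rdiv_lt_0_compat; exact: pos.
by rewrite S_INR /=; field; have := pow_lt q n; lra.
Qed.

(** The quotient is the sum of g_j sq (n - j) / sq n. Each ratio tends to 1 and grows at most
    quadratically in j, while g_j decays geometrically, so the limit may be taken termwise. *)
Lemma fmul_sq_asymptotics (g : fps) (G r : R) : 1 < r ->
  (forall n, Rabs (g n) * r ^ n <= 1) -> is_series g G ->
  is_lim_seq (fun n => (g * sq)%fps n / sq n) G.
Proof.
move=> Hr Hg HG.
have Hq : 0 < / r < 1.
  by split; [apply: Rinv_0_lt_compat; lra|rewrite -Rinv_1; apply: Rinv_lt_contravar; lra].
have gle j : Rabs (g j) <= (/ r) ^ j.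
  have rj := pow_lt r j ltac:(lra); rewrite pow_inv.
  by apply: (Rmult_le_reg_r (r ^ j)) => //; rewrite Rinv_l; [exact: Hg|lra].
have HM : ex_series (fun j => 3 * ((INR j + 1) ^ 2 * (/ r) ^ j)).
  exact: ex_series_scal_l (ex_series_sq_geom _ Hq).
have T : is_lim_seq (fun n => sum_f_R0 (fun j => g j * (sq (n - j) / sq n - 1)) n) 0.
  apply: (tannery (fun n j => g j * (sq (n - j) / sq n - 1)) _ HM) => [n j Hj|j].
    (* The constant 3 is 2 from the ratio bound plus 1 for the subtracted limit. *)
    have B : Rabs (sq (n - j) / sq n - 1) <= 3 * (INR j + 1) ^ 2.
      have B1 : Rabs (sq (n - j) / sq n) <= 2 * (INR j + 1) ^ 2.
        rewrite Rabs_div; last exact: sq_neq0.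
        apply: (Rmult_le_reg_r (Rabs (sq n))); first exact: Rabs_pos_lt (sq_neq0 n).
        rewrite /Rdiv Rmult_assoc Rinv_l ?Rmult_1_r; last exact: Rabs_no_R0 (sq_neq0 n).
        exact: sq_ratio_bound.
      have := Rabs_triang (sq (n - j) / sq n) (Ropp 1).
      have : 1 <= (INR j + 1) ^ 2 by have := pos_INR j; nra.
      by rewrite Rabs_Ropp Rabs_R1 /Rminus; lra.
    rewrite Rabs_mult; have := gle j => ?; have := Rabs_pos (g j) => ?.
    have := Rabs_pos (sq (n - j) / sq n - 1) => ?.
    apply: (Rle_trans _ ((/ r) ^ j * (3 * (INR j + 1) ^ 2))); last by lra.
    exact: Rmult_le_compat.
  have -> : 0 = g j * (1 - 1) by ring.
  apply: is_lim_seq_mult'; first exact: is_lim_seq_const.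
  by apply: is_lim_seq_minus'; [exact: sq_ratio_lim|exact: is_lim_seq_const].
have -> : G = G + 0 by ring.
have HG' : is_lim_seq (fun n => sum_f_R0 g n) G.
  by apply: (is_lim_seq_ext (sum_n g)) => [n|]; [rewrite sum_n_Reals|exact: HG].
apply: is_lim_seq_ext _ (is_lim_seq_plus' _ _ _ _ HG' T) => n.
rewrite -plus_sum /Rdiv Rmult_comm fmulE scal_sum.
by apply: sum_eq_le => j _; rewrite /Rdiv; ring.
Qed.

Lemma is_series_finite (f : fps) d : (forall n, (d < n)%nat -> f n = 0) ->
  is_series f (sum_f_R0 f d).
Proof.
move=> Hf.
have H n : (d <= n)%nat -> sum_f_R0 f n = sum_f_R0 f d.
  move=> Hn; rewrite -(subnK Hn); elim: (n - d)%nat => [|p IH]; first by rewrite add0n.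
  by rewrite addSn /= IH Hf; [ring|lia].
suff : is_lim_seq (sum_n f) (sum_f_R0 f d) by [].
apply: is_lim_seq_ext_loc _ (is_lim_seq_const _).
by exists d => n Hn; rewrite sum_n_Reals H //; lia.
Qed.

Lemma is_series_one : is_series (cst 1) 1.
Proof. by apply: (is_series_finite (cst 1) 0) => -[|n]. Qed.

Lemma sum_finite_le (f : fps) d n : (forall i, (d < i)%nat -> f i = 0) -> (forall i, 0 <= f i) ->
  sum_f_R0 f n <= sum_f_R0 f d.
Proof.
move=> Hf Hp; have [H|H] := leqP n d; first exact: sum_incr_le.
rewrite -(subnK (ltnW H)); elim: (n - d)%nat => [|p IH]; first by rewrite add0n; lra.
rewrite addSn [X in X <= _]/=.
by rewrite Hf; [lra|lia].
Qed.

(** Dividing [u] by sqrt (1 - X) leaves a series g with g^2 = 1 - y and geometrically decaying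
    coefficients; the limit is g(1). *)
Lemma sqrt_asymptotics (u y : fps) (d : nat) :
  (u * u = (1 - mono 1) * (1 - y))%fps -> u 0%nat = 1 -> y 0%nat = 0 ->
  (forall n, (d < n)%nat -> y n = 0) ->
  sum_f_R0 (fun i => Rabs (y i)) d < 1 ->
  is_lim_seq (fun n => u n / sq n) (sqrt (1 - sum_f_R0 y d)).
Proof.
move=> Eu u0 y0 yfin ylt.
set Y := sum_f_R0 _ d in ylt.
(* As y is a polynomial of coefficient norm strictly below 1, the norm of y(rX) is still at most 1
   for some r > 1. *)
have [r [r1 Hr]] : exists r, 1 < r /\ Y * r ^ d <= 1.
  have Y0 : 0 <= Y by apply: sum_ge0 => i; exact: Rabs_pos.
  case: (Req_dec Y 0) => [->|Yn0]; first by exists 2; lra.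
  have Hi : 1 < / Y by rewrite -Rinv_1; apply: Rinv_lt_contravar; lra.
  have [r [r1 Hr]] := root_gt1 _ d Hi; exists r; split=> //.
  by rewrite -(Rinv_r Y) //; apply: Rmult_le_compat_l; lra.
(* This is u / sqrt (1 - X), since 1 / sqrt (1 - X) = sqrt (1 - X) / (1 - X). *)
pose g := (u * sq * geom)%fps.
have Eg : (g * sq = u)%fps.
  have -> : (g * sq = u * (sq * sq) * geom)%fps by rewrite /g; ring.
  have -> : (u * (sq * sq) * geom = u * (geom * (sq * sq)))%fps by ring.
  by rewrite sq_sq geomE; ring.
have Egg : (g * g = 1 - y)%fps.
  have -> : (g * g = (u * u) * (sq * sq) * geom * geom)%fps by rewrite /g; ring.
  rewrite Eu sq_sq.
  have -> : ((1 - mono 1) * (1 - y) * (1 - mono 1) * geom * geom =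
     (1 - y) * (geom * (1 - mono 1)) * (geom * (1 - mono 1)))%fps by ring.
  by rewrite geomE; ring.
have g0 : g 0%nat = 1 by rewrite /g !fmul0 u0 /geom /=; ring.
pose w := (1 - g)%fps.
have w0 : w 0%nat = 0 by rewrite /w /fsub g0 /=; ring.
have Ew : (w + w = y + w * w)%fps.
  have -> : (w * w = 1 - g - g + g * g)%fps by rewrite /w; ring.
  by rewrite Egg /w; ring.
have Ew' : (scale r w + scale r w = scale r y + scale r w * scale r w)%fps.
  by rewrite -scale_mul -!scale_add Ew.
have Hyr n : sum_f_R0 (fun i => Rabs (scale r y i)) n <= 1.
  apply: (Rle_trans _ (sum_f_R0 (fun i => Rabs (scale r y i)) d)).
    apply: sum_finite_le => i; last exact: Rabs_pos.
    by move=> Hi; rewrite /scale yfin // Rmult_0_l Rabs_R0.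
  apply: Rle_trans Hr; rewrite Rmult_comm scal_sum; apply: sum_le_le => i Hi.
  rewrite /scale Rabs_mult (Rabs_pos_eq (r ^ i)); last by apply: pow_le; lra.
  by apply: Rmult_le_compat_l; [exact: Rabs_pos|apply: Rle_pow; [lra|lia]].
have Hw := sqrt_coef_bound _ _ _ Ew' Hyr.
have {}Hw n : sum_f_R0 (fun i => Rabs (w i) * r ^ i) n <= 1.
  rewrite (sum_eq_le _ (fun i => Rabs (scale r w i))); first by apply: Hw; rewrite /scale w0; ring.
  by move=> i _; rewrite /scale Rabs_mult (Rabs_pos_eq (r ^ i)) //; apply: pow_le; lra.
have rpos i : 1 <= r ^ i by apply: pow_R1_Rle; lra.
have wr i : 0 <= Rabs (w i) * r ^ i.
  by apply: Rmult_le_pos; [exact: Rabs_pos|have := rpos i; lra].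
have gbound n : Rabs (g n) * r ^ n <= 1.
  case: n => [|n]; first by rewrite g0 Rabs_R1 /=; lra.
  have -> : g n.+1 = - w n.+1 by rewrite /w /fsub /=; ring.
  rewrite Rabs_Ropp; have := Hw n.+1 => /=.
  by have := sum_ge0 (fun i => Rabs (w i) * r ^ i) n wr; rewrite /=; lra.
have Hsw n : sum_f_R0 (fun i => Rabs (w i)) n <= 1.
  apply: Rle_trans (Hw n); apply: sum_le_le => i _.
  by have := Rabs_pos (w i); have := rpos i; nra.
have [W HW] : ex_series (fun n => Rabs (w n)).
  suff : ex_finite_lim_seq (sum_n (fun n => Rabs (w n))) by [].
  apply: (ex_finite_lim_seq_incr _ 1) => n; rewrite sum_n_Reals //.
  by rewrite sum_n_Reals /=; have := Rabs_pos (w n.+1); lra.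
have exw : ex_series (fun n => Rabs (w n)) by exists W.
have [v Hv] := ex_series_Rabs _ exw.
have Hg : is_series g (1 - v).
  apply: (is_series_ext (fun n => minus (cst 1 n) (w n))) => [n|].
    by rewrite /w /fsub /minus /plus /opp /=; ring.
  exact: (is_series_minus (cst 1) w 1 v is_series_one Hv).
have exg : ex_series (fun n => Rabs (g n)).
  apply: (ex_series_le _ (fun n => (/ r) ^ n)).
    move=> n; rewrite /norm /= /abs /= Rabs_Rabsolu pow_inv.
    apply: (Rmult_le_reg_r (r ^ n)); first by have := rpos n; lra.
    by rewrite Rinv_l; [exact: gbound|have := rpos n; lra].
  have Hq : 0 < / r < 1.
    by split; [apply: Rinv_0_lt_compat; lra|rewrite -Rinv_1; apply: Rinv_lt_contravar; lra].
  exists (/ (1 - / r)); apply: is_series_geom; rewrite Rabs_pos_eq; lra.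
(* The Cauchy product evaluates g^2 = 1 - y at X = 1, giving g(1)^2 = 1 - y(1). *)
have Hgg := is_series_mult _ _ _ _ Hg Hg exg exg.
have Hy : is_series (1 - y)%fps (1 - sum_f_R0 y d).
  exact: (is_series_minus (cst 1) y 1 _ is_series_one (is_series_finite _ _ yfin)).
have EG : (1 - v) * (1 - v) = 1 - sum_f_R0 y d.
  rewrite -(is_series_unique _ _ Hy) -(is_series_unique _ _ Hgg).
  by apply: Series_ext => n; rewrite -Egg.
(* This settles the sign: g(1) = 1 - v is the nonnegative root. *)
have v1 : v <= 1.
  have Hv' : is_lim_seq (sum_n w) v by exact: Hv.
  apply: (is_lim_seq_le (sum_n w) (fun=> 1) v 1 _ Hv' (is_lim_seq_const 1)) => n.
  rewrite sum_n_Reals; apply: Rle_trans (Hsw n); apply: sum_le_le => i _.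
  exact: Rle_abs.
rewrite -EG sqrt_square; last by lra.
have := fmul_sq_asymptotics _ _ _ r1 gbound Hg.
by rewrite Eg.
Qed.

(** * Counting regular expressions *)

Lemma re_comparable k : comparable (re k).
Proof. by move=> x y; rewrite /decidable; decide equality; exact: eq_comparable. Qed.
HB.instance Definition _ k := hasDecEq.Build (re k) (compareP (@re_comparable k)).

(** Duplicate-free lists can be concatenated, filtered and compared up to permutation, which suits
    the counting below. *)
Lemma has_card_seq (T : eqType) (A : T -> Prop) N : has_card A N ->
  exists s : seq T, [/\ uniq s, size s = N & forall x, A x <-> x \in s].
Proof.
move=> [f [finj fA]]; exists [seq f i | i <- enum 'I_N]; split.
- by rewrite map_inj_uniq ?enum_uniq.
- by rewrite size_map size_enum_ord.
- move=> x; rewrite fA; split=> [[i <-]|/mapP[i _ ->]]; last by exists i.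
  by apply: map_f; rewrite mem_enum.
Qed.

Lemma uniq_flatten_map (I T : eqType) (F : I -> seq T) (s : seq I) :
  uniq s -> (forall i, i \in s -> uniq (F i)) ->
  (forall i j x, i \in s -> j \in s -> x \in F i -> x \in F j -> i = j) ->
  uniq (flatten [seq F i | i <- s]).
Proof.
elim: s => //= i s IH /andP[His Hs] HF Hd.
rewrite cat_uniq HF ?mem_head //= IH //; first last.
- by move=> a b x Ha Hb; apply: Hd; rewrite inE ?Ha ?Hb orbT.
- by move=> a Ha; apply: HF; rewrite inE Ha orbT.
rewrite andbT; apply/hasPn => x /flatten_mapP[j Hj xj]; apply/negP => xi.
by move: His; rewrite (Hd i j x) ?mem_head ?inE ?Hj ?orbT.
Qed.

Lemma INR_sumn_iota (F : nat -> nat) n :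
  INR (sumn [seq F i | i <- seq.iota 0%nat n.+1]) = sum_f_R0 (fun i => INR (F i)) n.
Proof.
elim: n => [|n IH]; first by rewrite /= addn0.
rewrite -addn1 iotaD map_cat sumn_cat [LHS]plus_INR IH.
by rewrite /= addn0.
Qed.

(** * Decomposition of expressions by their last constructor *)

Section Splits.
Variables (T : eqType) (c : T -> T -> T).

(** The counterpart of the Cauchy product for lists graded by an index. *)
Definition splits (l1 l2 : nat -> seq T) (n : nat) : seq T :=
  flatten [seq [seq c x y | x <- l1 i, y <- l2 (n - i)%nat] | i <- seq.iota 0%nat n.+1].

Lemma splitsP l1 l2 n t :
  reflect (exists i x y, [/\ (i <= n)%nat, x \in l1 i, y \in l2 (n - i)%nat & t = c x y])
    (t \in splits l1 l2 n).
Proof.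
apply: (iffP flatten_mapP) => [[i Hi /allpairsP[[x y] /= [Hx Hy ->]]]|[i [x [y [Hi Hx Hy ->]]]]].
  by exists i, x, y; split=> //; move: Hi; rewrite mem_iota; lia.
by exists i; [rewrite mem_iota; lia|apply: allpairs_f].
Qed.

(** The weight [w] recovers the index i from the left operand, so the blocks for different i are
    disjoint. *)
Lemma uniq_splits l1 l2 n (w : T -> nat) :
  (forall x y x' y', c x y = c x' y' -> x = x' /\ y = y') ->
  (forall i, uniq (l1 i)) -> (forall i, uniq (l2 i)) ->
  (forall i x, (i <= n)%nat -> x \in l1 i -> w x = i) ->
  uniq (splits l1 l2 n).
Proof.
move=> cinj U1 U2 Hw; apply: uniq_flatten_map; first exact: iota_uniq.
  move=> i _; apply: allpairs_uniq => // -[x y] [x' y'] _ _ /= /cinj[-> ->] //.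
move=> i j t; rewrite !mem_iota => Hi Hj /allpairsP[[x y] /= [Hx Hy ->]].
move=> /allpairsP[[x' y'] /= [Hx' Hy' /cinj[E _]]].
have := Hw j _ ltac:(lia) Hx'; rewrite -E => <-.
by have := Hw i _ ltac:(lia) Hx => <-.
Qed.

Lemma size_splits l1 l2 n :
  INR (size (splits l1 l2 n)) =
  fmul (fun i => INR (size (l1 i))) (fun i => INR (size (l2 i))) n.
Proof.
rewrite size_flatten /shape -map_comp INR_sumn_iota fmulE.
by apply: sum_eq_le => i _; rewrite /= size_allpairs [LHS]mult_INR.
Qed.

End Splits.

Arguments splits {T}.

Lemma Plus_inj k (x y x' y' : re k) : Plus x y = Plus x' y' -> x = x' /\ y = y'.
Proof. by case. Qed.
Lemma Cat_inj k (x y x' y' : re k) : Cat x y = Cat x' y' -> x = x' /\ y = y'.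
Proof. by case. Qed.

Lemma re_size_gt0 k (b : re k) : (0 < re_size b)%nat.
Proof. by case: b. Qed.

Section Grammar.
Variables (k : nat) (A Q : pred (re k)) (l q : nat -> seq (re k)).
Hypothesis l_uniq : forall n, uniq (l n).
Hypothesis q_uniq : forall n, uniq (q n).
Hypothesis lE : forall n t, (t \in l n) = (re_size t == n) && A t.
Hypothesis qE : forall n t, (t \in q n) = (re_size t == n) && Q t.
Hypothesis A_eps : A Eps.
Hypothesis A_lit : forall a, A (Lit a).
Hypothesis A_plus : forall x y, A (Plus x y) = Q x && Q y.
Hypothesis A_cat : forall x y, A (Cat x y) = A x && A y.
Hypothesis A_star : forall x, A (Star x) = A x.

Let f : fps := fun n => INR (size (l n)).
Let g : fps := fun n => INR (size (q n)).

(** The factor X pays for the last constructor: k + 1 atoms, a union of two members of [Q], a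
    concatenation of two members of [A], or a star. *)
Lemma grammar_gf : (f = mono 1 * (cst (INR k + 1) + g * g + f * f + f))%fps.
Proof.
apply: functional_extensionality => -[|n]; rewrite monoM_E ?ltn0Sn ?subn1.
  suff -> : f 0%nat = INR 0 by [].
  rewrite /f; congr INR; apply/eqP; rewrite size_eq0; apply/eqP/size0nil/eqP.
  rewrite -leqn0 leqNgt; apply/negP => /(mem_nth Eps).
  by rewrite lE => /andP[/eqP H _]; have := re_size_gt0 _ (nth Eps (l 0%nat) 0%nat); rewrite H.
rewrite [n.+1.-1]/=.
(* Here n is the size without the last constructor, so atoms occur for n = 0 only. *)
pose at1 : seq (re k) := if n is 0%nat then Eps :: [seq Lit a | a <- enum 'I_k] else [::].
pose SP := splits (@Plus k) q q n; pose SC := splits (@Cat k) l l n.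
have SPP t := splitsP _ (@Plus k) q q n t; have SCP t := splitsP _ (@Cat k) l l n t.
have SPS : INR (size SP) = (g * g)%fps n by exact: size_splits.
have SCS : INR (size SC) = (f * f)%fps n by exact: size_splits.
have SPU : uniq SP.
  apply: (uniq_splits _ _ _ _ _ (@re_size k) (@Plus_inj k)) => // i x _.
  by rewrite qE => /andP[/eqP].
have SCU : uniq SC.
  apply: (uniq_splits _ _ _ _ _ (@re_size k) (@Cat_inj k)) => // i x _.
  by rewrite lE => /andP[/eqP].
rewrite -/SP in SPP; rewrite -/SC in SCP; clearbody SP SC.
pose L := at1 ++ SP ++ SC ++ [seq Star x | x <- l n].
have at1P t : (t \in at1) = (n == 0)%nat && (if t is (Eps | Lit _) then true else false).
  rewrite /at1; case: (n) => //=; rewrite inE.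
  case: t => [|a|x y|x y|x] /=; rewrite ?eqxx //;
    try by apply/negP => /orP[/eqP|/mapP[]].
  by apply/orP; right; apply/mapP; exists a; rewrite ?mem_enum.
have LP t : (t \in L) = (t \in l n.+1).
  rewrite /L !mem_cat at1P lE.
  case: t => [|a|x y|x y|x] /=.
  - rewrite A_eps eqSS eq_sym andbT.
    case: eqP => //= _; apply/negbTE; rewrite !negb_or; apply/and3P; split.
    + by apply/negP => /SPP[i [x [y []]]].
    + by apply/negP => /SCP[i [x [y []]]].
    + by apply/negP => /mapP[].
  - rewrite A_lit eqSS eq_sym andbT.
    case: eqP => //= _; apply/negbTE; rewrite !negb_or; apply/and3P; split.
    + by apply/negP => /SPP[i [x [y []]]].
    + by apply/negP => /SCP[i [x [y []]]].
    + by apply/negP => /mapP[].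
  - rewrite andbF A_plus eqSS /=; apply/idP/idP.
      case/or3P => [/SPP[i [x' [y' [Hi + + [-> ->]]]]]|/SCP[i [x' [y' []]]]|/mapP[]] //.
      by rewrite !qE => /andP[/eqP -> ->] /andP[/eqP -> ->]; rewrite subnKC // eqxx.
    move=> /andP[/eqP En /andP[Hx Hy]]; apply/orP; left; apply/SPP.
    by exists (re_size x), x, y; rewrite !qE Hx Hy -En addKn !eqxx leq_addr.
  - rewrite andbF A_cat eqSS /=; apply/idP/idP.
      case/or3P => [/SPP[i [x' [y' []]]]|/SCP[i [x' [y' [Hi + + [-> ->]]]]]|/mapP[]] //.
      by rewrite !lE => /andP[/eqP -> ->] /andP[/eqP -> ->]; rewrite subnKC // eqxx.
    move=> /andP[/eqP En /andP[Hx Hy]]; apply/or3P; apply: Or32; apply/SCP.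
    by exists (re_size x), x, y; rewrite !lE Hx Hy -En addKn !eqxx leq_addr.
  - rewrite andbF A_star eqSS /=; apply/idP/idP.
      case/or3P => [/SPP[i [x' [y' []]]]|/SCP[i [x' [y' []]]]|/mapP[x' + [->]]] //.
      by rewrite lE.
    move=> H; apply/or3P; apply: Or33; apply: map_f; by rewrite lE.
have U1 : uniq at1.
  rewrite /at1; case: (n) => //=; rewrite map_inj_uniq ?enum_uniq ?andbT; last by move=> a b [].
  by apply/negP => /mapP[].
have LU : uniq L.
  rewrite /L !cat_uniq U1 map_inj_uniq ?l_uniq; last by move=> a b [].
  rewrite SPU SCU /= !andbT; apply/and3P; split; apply/hasPn => t; rewrite ?mem_cat.
  - by case/or3P => [/SPP[i [x [y [_ _ _ ->]]]]|/SCP[i [x [y [_ _ _ ->]]]]|/mapP[x _ ->]];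
      rewrite /= at1P andbF.
  - by case/orP => [/SCP[i [x [y [_ _ _ ->]]]]|/mapP[x _ ->]];
      apply/negP => /SPP[i' [x' [y' []]]].
  - by move=> /mapP[x _ ->]; apply/negP => /SCP[i' [x' [y' []]]].
have -> : f n.+1 = INR (size L).
  by rewrite /f; congr INR; apply/perm_size/uniq_perm.
rewrite /L !size_cat 3![INR (addn _ _)]plus_INR SPS SCS size_map /fadd.
have -> : INR (size at1) = cst (INR k + 1) n.
  by rewrite /at1; case: (n) => //; rewrite [size _]/= size_map size_enum_ord S_INR.
by rewrite /f; ring.
Qed.

End Grammar.

(** * Counting star expressions *)

(* Catalan numbers C_(n-1): the generating function is (1 - sqrt (1 - 4 X)) / 2. *)
Definition catalan : fps := fun n => if n is 0%nat then 0 else - sq n * 4 ^ n / 2.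

(** Squaring 1 - 2 c = sqrt (1 - 4 X) gives 1 - 4 c + 4 c^2 = 1 - 4 X. *)
Lemma catalan_mul : (catalan = mono 1 + catalan * catalan)%fps.
Proof.
have E : (scale 4 sq = 1 - catalan - catalan)%fps.
  apply: functional_extensionality => -[|n]; rewrite /scale /fsub /catalan /cst; last by field.
  by rewrite /=; ring.
have := scale_mul 4 sq sq; rewrite sq_sq scale_sub scale_cst scale_mono E.
have -> : ((1 - catalan - catalan) * (1 - catalan - catalan) =
  1 - cst 4 * catalan + cst 4 * (catalan * catalan))%fps.
  rewrite (_ : 4 = 1 + 1 + 1 + 1) ?fadd_cst; [ring|lra].
move=> H; apply: functional_extensionality => n.
by have := equal_f H n; rewrite /fsub /fadd !cstM_E; lra.
Qed.

Lemma union_leaves_size k (t : re k) s : union_leaves t = Some s -> (re_size t).+1 = (size s).*2.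
Proof.
elim: t s => //= [a s [<-] //|x IHx y IHy s].
case Ex: (union_leaves x) => [sx|] //; case Ey: (union_leaves y) => [sy|] // [<-].
by have := IHx _ Ex; have := IHy _ Ey; rewrite size_cat; lia.
Qed.

Lemma union_leaves_Plus k (x y : re k) s : union_leaves (Plus x y) = Some s ->
  exists sx sy, [/\ union_leaves x = Some sx, union_leaves y = Some sy & s = sx ++ sy].
Proof.
rewrite /=; case: (union_leaves x) => [sx|] //; case: (union_leaves y) => [sy|] // [<-].
by exists sx, sy.
Qed.

Lemma union_leaves_gt0 k (t : re k) s : union_leaves t = Some s -> (0 < size s)%nat.
Proof. by move/union_leaves_size; lia. Qed.

(** A union of letters contains no star at all. *)
Lemma union_leaves_na k (t : re k) s : union_leaves t = Some s -> in_RE_na t && ~~ sigma_star t.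
Proof.
elim: t s => //= x IHx y IHy s /union_leaves_Plus[sx [sy [/IHx Hx /IHy Hy _]]].
by move: Hx Hy => /andP[-> ->] /andP[-> ->].
Qed.

(** All bracketings of the word [s]. The fuel bounds its length, as the two halves are not
    structurally smaller. In [splits] the second index is j = size s - i, so dropping size s - j
    letters drops i. *)
Fixpoint trees {k} (fuel : nat) (s : seq 'I_k) : seq (re k) :=
  if fuel is f.+1 then
    if size s == 1%nat then [seq Lit a | a <- s]
    else splits (@Plus k) (fun i => trees f (take i s))
           (fun j => trees f (drop (size s - j)%nat s)) (size s)
  else [::].

Lemma trees_sound k f (s : seq 'I_k) t : t \in trees f s -> union_leaves t = Some s.
Proof.
elim: f s t => //= f IH s t; case: eqP => [|_].
  by case: s => [|a [|b s]] // _ /mapP[x]; rewrite inE => /eqP -> ->.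
move/splitsP => [i [x [y [Hi /IH Hx /IH Hy ->]]]].
by rewrite /= Hx Hy subKn // cat_take_drop.
Qed.

Lemma trees_complete k f (s : seq 'I_k) t : (size s <= f)%nat ->
  union_leaves t = Some s -> t \in trees f s.
Proof.
elim: f s t => [|f IH] s t Hs Ht /=; first by have := union_leaves_gt0 _ _ _ Ht; lia.
case: t Ht => // [a [<-]|x y /union_leaves_Plus[sx [sy [Ex Ey E]]]].
  by rewrite /= inE.
have sx0 := union_leaves_gt0 _ _ _ Ex; have sy0 := union_leaves_gt0 _ _ _ Ey.
have Ss : size s = (size sx + size sy)%nat by rewrite E size_cat.
rewrite (_ : (size s == 1)%nat = false); last by lia.
apply/splitsP; exists (size sx), x, y; split=> //; first by lia.
  by rewrite E take_size_cat //; apply: IH => //; lia.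
by rewrite subKn ?Ss ?leq_addr // E drop_size_cat //; apply: IH => //; lia.
Qed.

Lemma trees_uniq k f (s : seq 'I_k) : uniq (trees f s).
Proof.
elim: f s => //= f IH s; case: eqP => [|_]; first by case: s => [|a []].
(* A union with i leaves has size 2 i - 1, so half of size + 1 recovers i. *)
apply: (uniq_splits _ _ _ _ _ (fun x => (re_size x).+1./2) (@Plus_inj k)) => [i|i|i x Hi].
- exact: IH.
- exact: IH.
- by move/trees_sound/union_leaves_size; rewrite size_takel // => ->; rewrite doubleK.
Qed.

Lemma trees_nil k f : trees f ([::] : seq 'I_k) = [::].
Proof.
case E: (trees f [::]) => [|t l] //.
have : t \in trees f ([::] : seq 'I_k) by rewrite E mem_head.
by move/trees_sound/union_leaves_gt0.
Qed.

Lemma size_trees k f (s : seq 'I_k) : (size s <= f)%nat -> INR (size (trees f s)) = catalan (size s).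
Proof.
elim: f s => [|f IH] s Hs; first by rewrite (size0nil (_ : size s = 0%nat)) //; lia.
case: s Hs => [|a [|b s]] Hs; first by rewrite trees_nil.
  by rewrite /=; field.
set t := a :: b :: s in Hs *; have St : size t = (size s).+2 by [].
rewrite [trees _ _]/= -/t -St size_splits {1}catalan_mul /fadd (_ : mono 1 (size t) = 0) //.
rewrite Rplus_0_l !fmulE; apply: sum_eq_le => i Hi; cbv beta.
(* Splits with an empty half contribute 0 on both sides; they are set apart because the other half
   has full length and may exceed the fuel. *)
case: (posnP i) => [->|i0]; first by rewrite take0 trees_nil /=; ring.
case: (eqVneq i (size t)) => [->|ni].
  by rewrite subnn subn0 drop_size trees_nil /=; ring.
have Ei : size (take i t) = i by rewrite size_takel.
have Ed : size (drop i t) = (size t - i)%nat by rewrite size_drop.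
by rewrite subKn // !IH ?Ei ?Ed //; lia.
Qed.

(** There are k! orders of the letters and (2k-2)! / ((k-1)! k!) bracketings of each. *)
Lemma catalan_Ck k : (0 < k)%nat -> INR k`! * catalan k = Ck k.
Proof.
case: k => // m _; rewrite /Ck /catalan.
have -> : (2 * m.+1 - 2 = 2 * m)%nat by lia.
have -> : (m.+1 - 1 = m)%nat by lia.
elim: m => [|m IH]; first by rewrite /= /factorial /=; field.
have fne n : INR n`! <> 0 by apply: not_0_INR; have := fact_gt0 n; lia.
have -> : (2 * m.+1 = (2 * m).+2)%nat by lia.
have E3 : INR (2 * m)%nat = 2 * INR m by rewrite [LHS]mult_INR.
have := pos_INR m => Hm.
have F n : INR n.+1`! = (INR n + 1) * INR n`! by rewrite factS [LHS]mult_INR S_INR.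
have IH' : INR (2 * m)`! = INR m`! * (INR m.+1`! * (- sq m.+1 * 4 ^ m.+1 / 2)).
  by rewrite IH; field; exact: fne.
rewrite (F (2 * m).+1) (F (2 * m)%nat) IH' (sqS m.+1) !S_INR E3 !(F m.+1) !(F m) !S_INR.
rewrite (_ : 4 ^ m.+2 = 4 * 4 ^ m.+1) //.
by field; split; [exact: fne|lra].
Qed.

Definition stars k : seq (re k) :=
  [seq Star t | t <- flatten [seq trees k s | s <- permutations (enum 'I_k)]].

Lemma stars_uniq k : uniq (stars k).
Proof.
rewrite map_inj_uniq; last by move=> x y [].
apply: uniq_flatten_map; first exact: permutations_uniq.
  by move=> s _; exact: trees_uniq.
by move=> s s' t _ _ /trees_sound E /trees_sound; rewrite E => -[].
Qed.

Lemma mem_stars k (t : re k) : (t \in stars k) = sigma_star t.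
Proof.
apply/mapP/idP => [[x /flatten_mapP[s]]|].
  by rewrite mem_permutations => Hp /trees_sound E -> /=; rewrite E.
case: t => // t /=; case E: (union_leaves t) => [s|] // Hp.
exists t => //; apply/flatten_mapP; exists s; first by rewrite mem_permutations.
by apply: trees_complete E; rewrite (perm_size Hp) size_enum_ord.
Qed.

Lemma size_stars k : (0 < k)%nat -> INR (size (stars k)) = Ck k.
Proof.
move=> k0; rewrite -catalan_Ck // size_map size_flatten /shape -map_comp.
have Hsz s : s \in permutations (enum 'I_k) -> size s = k.
  by rewrite mem_permutations => /perm_size ->; rewrite size_enum_ord.
have := size_permutations (enum_uniq 'I_k); rewrite size_enum_ord => <-.
elim: (permutations _) Hsz => [|s l IH] H; first by rewrite /=; ring.
rewrite [size (s :: l)]/= [map _ _]/= [sumn _]/= [LHS]plus_INR IH; last first.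
  by move=> x Hx; apply: H; rewrite inE Hx orbT.
have Hs := H s (mem_head _ _).
by rewrite size_trees ?Hs // S_INR Rmult_plus_distr_r Rmult_1_l Rplus_comm.
Qed.

Lemma re_size_star k (t : re k) : sigma_star t -> re_size t = (2 * k)%nat.
Proof.
case: t => // t /=; case E: (union_leaves t) => [s|] // /perm_size.
by rewrite size_enum_ord (union_leaves_size _ _ _ E) => ->; lia.
Qed.

Lemma star_na k (t : re k) : sigma_star t -> in_RE_na t.
Proof.
by case: t => // t /=; case E: (union_leaves t) => [s|] // _; case/andP: (union_leaves_na _ _ _ E).
Qed.

(** * Equations for the generating functions of B and R *)

Lemma coef_lists k (P : pred (re k)) (N : nat -> nat) :
  (forall n, has_card (fun b : re k => re_size b = n /\ P b) (N n)) ->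
  exists l : nat -> seq (re k), [/\ forall n, uniq (l n), forall n, size (l n) = N n &
    forall n t, (t \in l n) = (re_size t == n) && P t].
Proof.
move=> H; have [l Hl] := functional_choice _ (fun n => has_card_seq _ _ _ (H n)).
exists l; split=> n; try by case: (Hl n).
case: (Hl n) => _ _ H3 t; apply/idP/andP => [/H3[-> ->]|[/eqP H1 H2]] //.
by apply/H3.
Qed.

Lemma B_gf k Bc : is_coef_B k Bc ->
  let f : fps := fun n => INR (Bc n) in
  (f = mono 1 * (cst (INR k + 1) + f * f + f * f + f))%fps.
Proof.
move=> HB f.
have /coef_lists[l [U S E]] : forall n, has_card (fun b : re k => re_size b = n /\ predT b) (Bc n).
  move=> n; have [g [g1 g2]] := HB n; exists g; split=> // x; rewrite -g2.
  by split=> [[]|].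
have -> : f = fun n => INR (size (l n)).
  by apply: functional_extensionality => n; rewrite /f S.
exact: (grammar_gf k predT predT l l).
Qed.

(** The operands of + are the members of the class that are not star expressions. All C_k star
    expressions lie in the class and have size 2k, so their series is f - C_k X^(2k). *)
Lemma R_gf k Rc : (0 < k)%nat -> is_coef_R k Rc ->
  let f : fps := fun n => INR (Rc n) in
  let g := (f - cst (Ck k) * mono (2 * k))%fps in
  (f = mono 1 * (cst (INR k + 1) + g * g + f * f + f))%fps.
Proof.
move=> k0 HR f g.
have [l [U S E]] := coef_lists _ _ _ HR.
pose Q (t : re k) := in_RE_na t && ~~ sigma_star t.
pose q n := [seq t <- l n | ~~ sigma_star t].
have Ef : f = fun n => INR (size (l n)).
  by apply: functional_extensionality => n; rewrite /f S.
have Eg : g = fun n => INR (size (q n)).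
  apply: functional_extensionality => n; rewrite /g Ef /fsub cstM_E /mono.
  have -> : INR (size (l n)) = INR (size (q n)) + INR (size [seq t <- l n | sigma_star t]).
    rewrite -plus_INR; congr INR; rewrite /q !size_filter -(count_predC (@sigma_star k)).
    by rewrite addnC.
  case: eqP => [En|En].
    have -> : size [seq t <- l n | sigma_star t] = size (stars k).
      apply/perm_size/uniq_perm; rewrite ?filter_uniq ?stars_uniq // => t.
      rewrite mem_filter mem_stars E; case Ht: (sigma_star t) => //=.
      by rewrite star_na // (re_size_star _ _ Ht) En eqxx.
    by rewrite size_stars //; ring.
  have -> : [seq t <- l n | sigma_star t] = [::].
    rewrite -(filter_pred0 (l n)); apply: eq_in_filter => t; rewrite E => /andP[/eqP Hn _].
    by apply/negP => /re_size_star H; apply: En; rewrite -Hn H.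
  by rewrite /=; ring.
rewrite Eg Ef; apply: (grammar_gf k (@in_RE_na k) Q l q) => //.
- by move=> n; rewrite filter_uniq.
- by move=> n t; rewrite mem_filter E /Q andbC andbA.
- by move=> x y; rewrite /Q /=; do !case: (sigma_star _); rewrite ?andbF ?andbT.
Qed.

(** * Singular factorisation of the discriminants *)

(** Completes the square in 2 z f^2 - b f + z (c + s^2) = 0. *)
Lemma quadratic_discriminant (f s c z : fps) :
  (f = z * (c + (f - s) * (f - s) + f * f + f))%fps ->
  let b := (1 - z + (z * s + z * s))%fps in
  let two := (1 + 1)%fps in
  ((b - two * two * (z * f)) * (b - two * two * (z * f)) =
   b * b - two * two * two * (z * z * (c + s * s)))%fps.
Proof.
move=> H b two.
have E : (z * (c + s * s) = f * b - two * (z * f * f))%fps.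
  have -> : (f * b - two * (z * f * f) =
     f + (f * (z * s + z * s) - z * f - two * (z * f * f)))%fps by rewrite /b /two; ring.
  by rewrite {1}H /two; ring.
have -> : (z * z * (c + s * s) = z * (z * (c + s * s)))%fps by ring.
by rewrite E /b /two; ring.
Qed.

Section Factorisation.
Variables (k : nat) (s e : R).

Let t := 4 * s * e.
(* With s = C_k e^(2k), the discriminant evaluated at e X is (1 - X)(1 - remainder) as soon as it
   vanishes at X = 1; s = 0 is the case of B. *)
Definition remainder : fps :=
  (cst (2 * e - 1) * mono 1 + cst t * gs 2 (2 * k + 1) - cst (t * e) * gs 2 (2 * k + 2)
   - cst (t * (s * e)) * gs 2 (4 * k + 2))%fps.

Hypothesis k_gt0 : (0 < k)%nat.

(** The discriminant vanishes at X = 1, so its coefficient of X^2 is determined by the others.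
    Substituting it pairs every higher monomial X^n with X^2, and X^2 - X^n is divisible by 1 -
    X. *)
Lemma remainder_fact :
  1 - 2 * e - (7 + 8 * INR k) * e ^ 2 + t * (1 - e - s * e) = 0 ->
  let z := (cst e * mono 1)%fps in
  let p := (cst s * mono (2 * k))%fps in
  let b := (1 - z + (z * p + z * p))%fps in
  let two := (1 + 1)%fps in
  (b * b - two * two * two * (z * z * (cst (INR k + 1) + p * p)) =
   (1 - mono 1) * (1 - remainder))%fps.
Proof.
move=> He z p b two.
have -> : ((1 - mono 1) * (1 - remainder) =
  (1 - mono 1) * (1 - cst (2 * e - 1) * mono 1) - cst t * ((1 - mono 1) * gs 2 (2 * k + 1))
  + cst (t * e) * ((1 - mono 1) * gs 2 (2 * k + 2))
  + cst (t * (s * e)) * ((1 - mono 1) * gs 2 (4 * k + 2)))%fps by rewrite /remainder; ring.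
rewrite !gsE; try lia.
have -> : mono (2 * k + 1) = (mono 1 * mono (2 * k))%fps by rewrite mono_mul addnC.
have -> : mono (2 * k + 2) = (mono 1 * mono 1 * mono (2 * k))%fps by rewrite !mono_mul addnC.
have -> : mono (4 * k + 2) = (mono 1 * mono 1 * mono (2 * k) * mono (2 * k))%fps.
  by rewrite !mono_mul; congr mono; lia.
have -> : mono 2 = (mono 1 * mono 1)%fps by rewrite mono_mul.
have E2 : cst 2 = two by rewrite /two -fadd_cst; congr cst; lra.
have Et : cst t = (two * two * cst s * cst e)%fps.
  by rewrite -E2 -!fmul_cst; congr cst; rewrite /t; ring.
(* The root condition solved for 8 k e^2, which eliminates k from the identity. *)
have Hk : (two * two * two * cst (INR k) * cst e * cst e =
   1 - two * cst e - two * two * two * cst e * cst e + cst e * cst e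
   + cst t * (1 - cst e - cst s * cst e))%fps.
  rewrite -E2 -!fmul_cst -!fsub_cst -!fmul_cst -!fadd_cst; congr cst; lra.
rewrite !fmul_cst fsub_cst fmul_cst fadd_cst E2 /b /z /p.
set X := mono 1; set P := mono (2 * k).
have -> : ((1 - cst e * X + (cst e * X * (cst s * P) + cst e * X * (cst s * P))) *
  (1 - cst e * X + (cst e * X * (cst s * P) + cst e * X * (cst s * P))) -
  two * two * two * (cst e * X * (cst e * X) * (cst (INR k) + 1 + cst s * P * (cst s * P))) =
  1 - two * cst e * X + cst e * cst e * X * X
  + two * two * cst e * cst s * X * P * (1 - cst e * X)
  - two * two * two * cst e * cst e * X * X
  - two * two * cst e * cst e * cst s * cst s * X * X * P * P
  - (two * two * two * cst (INR k) * cst e * cst e) * X * X)%fps by rewrite /two; ring.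
by rewrite Hk Et /two; ring.
Qed.

Lemma sum_gs m n d : (m <= n)%nat -> (n <= d.+1)%nat -> sum_f_R0 (gs m n) d = INR n - INR m.
Proof.
move=> Hmn Hn; rewrite -minus_INR; last by lia.
suff H : forall d', sum_f_R0 (gs m n) d' = INR (minn n d'.+1 - m).
  by rewrite H (minn_idPl Hn).
elim=> [|d' IH].
  by rewrite /= /gs; case: ifP => H; rewrite -?[1]/(INR 1) -?[0]/(INR 0); congr INR; lia.
rewrite [LHS]/= IH /gs; case: ifP => H.
  by rewrite -S_INR; congr INR; lia.
by rewrite Rplus_0_r; congr INR; lia.
Qed.

Lemma sum_scal c (f : fps) d : sum_f_R0 (fun i => c * f i) d = c * sum_f_R0 f d.
Proof. by rewrite scal_sum; apply: sum_eq_le => i _; ring. Qed.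

Let d := (4 * k + 2)%nat.

Lemma mono1_gs : mono 1 = gs 1 2.
Proof. by apply: functional_extensionality => -[|[|i]]. Qed.

Lemma INR_2k j : INR (2 * k + j)%nat = 2 * INR k + INR j.
Proof. by rewrite [LHS]plus_INR [X in X + _ = _]mult_INR. Qed.
Lemma INR_4k j : INR (4 * k + j)%nat = 4 * INR k + INR j.
Proof. by rewrite [LHS]plus_INR [X in X + _ = _]mult_INR /=; ring. Qed.

Lemma sum_remainder : sum_f_R0 remainder d =
  (2 * e - 1) + t * (2 * INR k - 1) - t * e * (2 * INR k) - t * (s * e) * (4 * INR k).
Proof.
rewrite (sum_eq_le _ (fun i => ((2 * e - 1) * mono 1 i + t * gs 2 (2 * k + 1) i)
   - (t * e * gs 2 (2 * k + 2) i + t * (s * e) * gs 2 (4 * k + 2) i))); last first.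
  by move=> i _; rewrite /remainder /fsub /fadd !cstM_E; ring.
rewrite minus_sum !plus_sum !sum_scal mono1_gs !sum_gs /d; try lia.
by rewrite !INR_2k INR_4k /=; ring.
Qed.

(** The triangle inequality over blocks of lengths 1, 2k - 1, 2k and 4k; 2 e <= 1 fixes the sign of
    the linear coefficient. *)
Lemma norm_remainder : 0 <= s -> 0 <= e -> 2 * e <= 1 ->
  sum_f_R0 (fun i => Rabs (remainder i)) d <=
  (1 - 2 * e) + t * (2 * INR k - 1) + t * e * (2 * INR k) + t * (s * e) * (4 * INR k).
Proof.
move=> Hs He He2.
have t0 : 0 <= t by apply: Rmult_le_pos => //; lra.
have te0 : 0 <= t * e by exact: Rmult_le_pos.
have tse0 : 0 <= t * (s * e) by apply: Rmult_le_pos => //; exact: Rmult_le_pos.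
have gs0 m n i : 0 <= gs m n i by rewrite /gs; case: ifP; lra.
apply: (Rle_trans _ (sum_f_R0 (fun i => ((1 - 2 * e) * mono 1 i + t * gs 2 (2 * k + 1) i)
   + (t * e * gs 2 (2 * k + 2) i + t * (s * e) * gs 2 (4 * k + 2) i)) d)).
  apply: sum_le_le => i _; rewrite /remainder /fsub /fadd !cstM_E mono1_gs.
  have a1 := Rmult_le_pos _ _ (_ : 0 <= 1 - 2 * e) (gs0 1%nat 2%nat i).
  have a2 := Rmult_le_pos _ _ t0 (gs0 2%nat (2 * k + 1)%nat i).
  have a3 := Rmult_le_pos _ _ te0 (gs0 2%nat (2 * k + 2)%nat i).
  have a4 := Rmult_le_pos _ _ tse0 (gs0 2%nat (4 * k + 2)%nat i).
  have {}a1 := a1 ltac:(lra).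
  by apply: Rabs_le; lra.
rewrite !plus_sum !sum_scal mono1_gs !sum_gs /d; try lia.
by rewrite !INR_2k INR_4k /=; apply: Req_le; ring.
Qed.

Lemma remainder0 : remainder 0%nat = 0.
Proof. by rewrite /remainder /fsub /fadd !cstM_E /mono /gs /=; ring. Qed.

Lemma remainder_finite n : (d < n)%nat -> remainder n = 0.
Proof.
rewrite /d => Hn; rewrite /remainder /fsub /fadd !cstM_E mono1_gs /gs.
by rewrite !ifF; [ring|lia..].
Qed.

End Factorisation.

(** * Asymptotics of both coefficient sequences *)

(** With c = 0 this treats B, with c = C_k it treats R. The last inequality says that the bound on
    the coefficient norm of [remainder] is below 1. *)
Lemma coef_asymptotics k (c e : R) (f : fps) : (0 < k)%nat -> 0 <= c -> 0 < e -> 2 * e < 1 ->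
  let p := (cst c * mono (2 * k))%fps in
  (f = mono 1 * (cst (INR k + 1) + (f - p) * (f - p) + f * f + f))%fps ->
  let s := c * e ^ (2 * k) in
  1 - 2 * e - (7 + 8 * INR k) * e ^ 2 + 4 * s * e * (1 - e - s * e) = 0 ->
  2 * s * (2 * INR k - 1 + 2 * INR k * e + 4 * INR k * (s * e)) < 1 ->
  is_lim_seq (fun n => - 4 * f n * e ^ n.+1 / sq n.+1)
    (sqrt (2 - 2 * e - 4 * s * e * (2 * INR k - 1 - 2 * INR k * e - 4 * INR k * (s * e)))).
Proof.
move=> k0 c0 e0 e1 p Ef s Hs Hsmall.
have s0 : 0 <= s by apply: Rmult_le_pos => //; apply: pow_le; lra.
pose b := (1 - mono 1 + (mono 1 * p + mono 1 * p))%fps.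
pose two := (1 + 1)%fps.
pose u := (b - two * two * (mono 1 * f))%fps.
have Eu : (u * u = b * b - two * two * two * (mono 1 * mono 1 * (cst (INR k + 1) + p * p)))%fps.
  exact: quadratic_discriminant.
have Ep : scale e p = (cst s * mono (2 * k))%fps.
  by rewrite /p scale_mul scale_cst scale_mono /s fmul_cst; ring.
have Esu : (scale e u * scale e u = (1 - mono 1) * (1 - remainder k s e))%fps.
  rewrite -(remainder_fact _ _ _ k0 Hs) -scale_mul Eu /b /two.
  move: (p) Ep => p0 Ep.
  rewrite !(scale_sub, scale_add, scale_mul, scale_cst) Ep !scale_mono pow_1.
  by [].
(* The polynomial b has degree at most 2k + 1, so beyond that only - 4 X f contributes, shifted by
   one index. *)
have u1 n : (2 * k < n)%nat -> u n.+1 = - 4 * f n.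
  move=> Hn; have -> : u = (1 - mono 1 + (mono 1 * p + mono 1 * p) - cst 4 * (mono 1 * f))%fps.
    by rewrite /u /b /two (_ : 4 = 1 + 1 + 1 + 1) ?fadd_cst; [ring|lra].
  rewrite /fsub /fadd cstM_E !monoM_E ltn0Sn subn1 [n.+1.-1]/= /p cstM_E /mono.
  by rewrite !ifF; [rewrite /=; ring|lia|lia].
have Y := norm_remainder k s e k0 s0 ltac:(lra) ltac:(lra).
have Hlim : is_lim_seq (fun n => scale e u n / sq n)
    (sqrt (1 - sum_f_R0 (remainder k s e) (4 * k + 2))).
  apply: sqrt_asymptotics Esu _ (remainder0 _ _ _) (remainder_finite _ _ _ k0) _.
    by rewrite /scale /u /b /two /fsub /fadd !fmul0 /mono /=; ring.
  apply: Rle_lt_trans Y _.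
  have : 0 < e * (1 - 2 * s * (2 * INR k - 1 + 2 * INR k * e + 4 * INR k * (s * e))).
    by apply: Rmult_lt_0_compat; lra.
  by lra.
rewrite (sum_remainder _ _ _ k0) in Hlim.
rewrite (_ : 2 - 2 * e - _ = 1 - (2 * e - 1 + 4 * s * e * (2 * INR k - 1) -
    4 * s * e * e * (2 * INR k) - 4 * s * e * (s * e) * (4 * INR k))); last by ring.
apply: is_lim_seq_ext_loc _ (proj1 (is_lim_seq_incr_1 _ _) Hlim).
by exists (2 * k).+1 => n Hn; rewrite /scale u1 //; lia.
Qed.

(** * Estimates for C_k and values at the roots *)

Lemma fact_le_pow m j : (j <= m)%nat -> ((m + j)`! <= expn (2 * m) j * m`!)%nat.
Proof.
elim: j => [|j IH] Hj; first by rewrite addn0 mul1n.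
rewrite addnS factS expnS -mulnA; apply: leq_mul; first by lia.
by apply: IH; lia.
Qed.

Lemma Ck_bound k : (0 < k)%nat -> 0 <= Ck k <= (2 * INR k) ^ (k - 1).
Proof.
case: k => // m _; rewrite /Ck.
have -> : (2 * m.+1 - 2 = m + m)%nat by lia.
have -> : (m.+1 - 1 = m)%nat by lia.
have fpos n : 0 < INR n`! by apply: lt_0_INR; have := fact_gt0 n; lia.
split; first by apply: Rlt_le; apply: Rdiv_lt_0_compat.
apply: (Rle_trans _ ((2 * INR m) ^ m)); last first.
  by apply: pow_incr; rewrite S_INR; have := pos_INR m; lra.
apply: (Rmult_le_reg_r (INR m`!)) => //; rewrite /Rdiv Rmult_assoc Rinv_l ?Rmult_1_r; last first.
  by have := fpos m; lra.
have := fact_le_pow m m (leqnn m) => /leP/le_INR; rewrite [X in _ <= X]mult_INR.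
suff -> : INR (expn (2 * m) m) = (2 * INR m) ^ m by [].
have -> : 2 * INR m = INR (2 * m)%nat by rewrite [RHS]mult_INR.
by elim: {2 4}m => //= j IH; rewrite expnS [LHS]mult_INR IH.
Qed.

(** Since k e^2 < 1/8 and k - 1 >= 1, C_k e^(2k) <= (2 k e^2)^(k-1) e^2 <= e^2 / 4; multiplying by k
    gives 1/32. *)
Lemma Ck_pow_bound k e : (2 <= k)%nat -> 0 < e -> (8 + 8 * INR k) * e ^ 2 < 1 ->
  0 <= Ck k * e ^ (2 * k) /\ 32 * INR k * (Ck k * e ^ (2 * k)) <= 1.
Proof.
move=> k2 e0 He.
have [C0 C1] := Ck_bound k ltac:(lia).
have kk : 2 <= INR k by apply: (le_INR 2); lia.
have -> : e ^ (2 * k) = (e ^ 2) ^ (k - 1) * e ^ 2.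
  by rewrite -pow_mult -pow_add; congr (_ ^ _); lia.
set q := e ^ 2 in He *; have q0 : 0 < q by apply: pow_lt.
have qp := pow_lt q (k - 1) q0.
split; first by apply: Rmult_le_pos => //; apply: Rmult_le_pos; lra.
have H1 : Ck k * q ^ (k - 1) <= (2 * INR k * q) ^ (k - 1).
  by rewrite Rpow_mult_distr; apply: Rmult_le_compat_r; lra.
have kq : 2 * INR k * q <= / 4 by lra.
have H2 : (2 * INR k * q) ^ (k - 1) <= / 4.
  have -> : (k - 1 = (k - 2).+1)%nat by lia.
  have kq0 : 0 <= 2 * INR k * q by nra.
  have : (2 * INR k * q) ^ (k - 2) <= 1 ^ (k - 2) by apply: pow_incr; lra.
  have := pow_le _ (k - 2) kq0; rewrite pow1 /= => ? ?.
  by apply: (Rle_trans _ (2 * INR k * q * 1)); [apply: Rmult_le_compat_l; lra|lra].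
have H3 : (Ck k * q ^ (k - 1)) * (INR k * q) <= / 4 * (INR k * q).
  by apply: Rmult_le_compat_r; nra.
nra.
Qed.

(** Adding the equation Deltak k e = 0 twice removes (7 + 8k) e^2 from - e Delta_k'(e) and leaves 1
    - y(1), the squared limit in [coef_asymptotics]. *)
Lemma psikE k e : let s := Ck k * e ^ (2 * k) in Deltak k e = 0 ->
  1 - 2 * e - (7 + 8 * INR k) * e ^ 2 + 4 * s * e * (1 - e - s * e) = 0 /\
  psik k e = 2 - 2 * e - 4 * s * e * (2 * INR k - 1 - 2 * INR k * e - 4 * INR k * (s * e)).
Proof.
set m := (2 * k)%nat; move=> s HD.
have E1 : e ^ (2 * k + 1) = e * e ^ m by rewrite addn1.
have H1 : 1 - 2 * e - (7 + 8 * INR k) * e ^ 2 + 4 * s * e * (1 - e - s * e) = 0.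
  by move: HD; rewrite /Deltak /pk /hk E1 /s; lra.
split=> //.
have Em : INR m = 2 * INR k by rewrite [LHS]mult_INR.
have D : is_derive (Deltak k) e (- 2 - 2 * (7 + 8 * INR k) * e +
   4 * (INR m + 1) * s * (1 - e - s * e) + 4 * (e * s) * (- 1 - (INR m + 1) * s)).
  apply: (is_derive_ext (fun z => 1 - 2 * z - (7 + 8 * INR k) * z ^ 2 +
    4 * z ^ m.+1 * Ck k * (1 - z - Ck k * z ^ m.+1))) => [z|].
    by rewrite /Deltak /pk /hk addn1.
  by auto_derive => //; rewrite -/(INR m.+1) S_INR /s; ring.
rewrite /psik (is_derive_unique _ _ _ D) Em.
by lra.
Qed.

Lemma rhokP k : (2 <= k)%nat -> let r := rhok k in
  [/\ 0 < r, 4 * r < 1 & 1 - 2 * r - (7 + 8 * INR k) * r ^ 2 = 0].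
Proof.
move=> k2 r.
have kk : 2 <= INR k by apply: (le_INR 2); lia.
set q := sqrt (8 + 8 * INR k).
have q2 : q * q = 8 + 8 * INR k by rewrite sqrt_sqrt; lra.
have q0 : 0 <= q by exact: sqrt_pos.
have q4 : 4 < q by nra.
have Er : r * (1 + q) = 1 by rewrite /r /rhok -/q; field; lra.
have r0 : 0 < r by apply: Rdiv_lt_0_compat; rewrite -/q; lra.
split=> //; first by have := Rmult_lt_compat_l _ _ _ r0 q4; lra.
have -> : 7 + 8 * INR k = q * q - 1 by lra.
have Eq : r * q = 1 - r by lra.
(* With q^2 = 8 + 8k, this equation is p_k(r) = 0. *)
have : (r * q) ^ 2 = (1 - r) ^ 2 by rewrite Eq.
by rewrite /=; lra.
Qed.

(** * Quotient of the two asymptotics *)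

Lemma quotient_lim (f g sg : nat -> R) (e r a b : R) : e <> 0 -> r <> 0 -> a <> 0 -> b <> 0 ->
  (forall n, sg n <> 0) ->
  is_lim_seq (fun n => - 4 * f n * e ^ n.+1 / sg n.+1) a ->
  is_lim_seq (fun n => - 4 * g n * r ^ n.+1 / sg n.+1) b ->
  is_lim_seq (fun n => (f n / g n) / (a / b * (r / e) ^ n.+1)) 1.
Proof.
move=> He Hr Ha Hb Hsg Hf Hg.
have H := is_lim_seq_div' _ _ _ _ Hf Hg Hb.
have := is_lim_seq_mult' _ _ _ _ H (is_lim_seq_const (b / a)).
rewrite (_ : a / b * (b / a) = 1); last by field.
apply: is_lim_seq_ext => n.
have en := pow_nonzero e n.+1 He; have rn := pow_nonzero r n.+1 Hr.
rewrite /Rdiv Rpow_mult_distr pow_inv.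
(* If [g n] is 0, both sides are 0 because the inverse of 0 is 0. *)
case: (Req_dec (g n) 0) => [->|gn]; last by field.
by rewrite !(Rmult_0_r, Rmult_0_l, Rinv_0).
Qed.

Theorem theorem3 (k : nat) (Bc Rc : nat -> nat) (eta : R) :
  (2 <= k)%nat ->
  is_coef_B k Bc -> is_coef_R k Rc ->
  0 < eta < 1 / sqrt (8 + 8 * INR k) ->
  Deltak k eta = 0 ->
  (forall z, 0 < z < 1 / sqrt (8 + 8 * INR k) -> Deltak k z = 0 -> z = eta) ->
  is_lim_seq
    (fun n : nat =>
       (INR (Rc n) / INR (Bc n)) /
       (sqrt (psik k eta) / sqrt (2 - 2 * rhok k) * (rhok k / eta) ^ (n + 1)))
    1.
Proof.
move=> k2 HB HR [eta0 eta1] HD _.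
have kk : 2 <= INR k by apply: (le_INR 2); lia.
have k0 : (0 < k)%nat by lia.
have eta2 : (8 + 8 * INR k) * eta ^ 2 < 1.
  set q := sqrt (8 + 8 * INR k) in eta1.
  have q2 : q * q = 8 + 8 * INR k by rewrite sqrt_sqrt; lra.
  have q0 : 0 < q by apply: sqrt_lt_R0; lra.
  have eq1 : eta * q < 1.
    by have := Rmult_lt_compat_r _ _ _ q0 eta1; rewrite /Rdiv Rmult_1_l Rinv_l //; lra.
  by have := Rmult_lt_0_compat _ _ eta0 q0; rewrite -q2; nra.
have eta4 : 4 * eta < 1 by nra.
have [s0 s1] := Ck_pow_bound k eta k2 eta0 eta2.
have [Hs Epsi] := psikE k eta HD.
set s := Ck k * eta ^ (2 * k) in s0 s1 Hs Epsi.
have sk : 0 <= INR k * s by nra.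
have se : 0 <= s * eta <= / 4 by nra.
(* From k s <= 1/32, 4 eta < 1 and s eta <= 1/4, the left side is at most (4 + 1 + 2) / 32. *)
have small : 2 * s * (2 * INR k - 1 + 2 * INR k * eta + 4 * INR k * (s * eta)) < 1.
  apply: (Rle_lt_trans _ (INR k * s * (4 + 4 * eta + 8 * (s * eta)))); first by nra.
  by nra.
have limR := coef_asymptotics k (Ck k) eta (fun n => INR (Rc n)) k0 (proj1 (Ck_bound k k0))
  eta0 ltac:(lra) (R_gf k Rc k0 HR) Hs small.
rewrite -/s -Epsi in limR.
have [r0 r4 Hr] := rhokP k k2.
(* The instance c = 0: here p = 0, s = 0, and the root condition becomes p_k(rho_k) = 0. *)
have gfB : let f : fps := fun n => INR (Bc n) in let p := (cst 0 * mono (2 * k))%fps in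
    (f = mono 1 * (cst (INR k + 1) + (f - p) * (f - p) + f * f + f))%fps.
  move=> f p; have -> : (f - p = f)%fps by rewrite /p; ring.
  exact: B_gf.
have limB := coef_asymptotics k 0 (rhok k) (fun n => INR (Bc n)) k0 (Rle_refl 0)
  r0 ltac:(lra) gfB ltac:(lra) ltac:(lra).
rewrite (_ : 2 - 2 * rhok k - _ = 2 - 2 * rhok k) in limB; last by ring.
(* psi is 2 - 4 eta plus 2 times the first and 16 times the second quantity below. *)
have psi_pos : 0 < psik k eta.
  rewrite Epsi.
  have : 0 <= eta * (1 - 2 * s * (2 * INR k - 1 + 2 * INR k * eta + 4 * INR k * (s * eta))).
    by apply: Rmult_le_pos; lra.
  have : 0 <= INR k * s * (eta * (eta + 2 * (s * eta))).
    by apply: Rmult_le_pos => //; apply: Rmult_le_pos; lra.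
  by lra.
apply: (is_lim_seq_ext (fun n => (INR (Rc n) / INR (Bc n)) /
  (sqrt (psik k eta) / sqrt (2 - 2 * rhok k) * (rhok k / eta) ^ n.+1))) => [n|].
  by rewrite addn1.
apply: (quotient_lim _ _ sq) limR limB; try lra; last exact: sq_neq0.
- by apply: Rgt_not_eq; apply: sqrt_lt_R0.
- by apply: Rgt_not_eq; apply: sqrt_lt_R0; lra.
Qed.
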